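(* Consider the translation from $\mathsf{CL}_{\rm b}$ to $\mathsf{CLL}_{\rm b}$ obtained by composing the Kuroda translation $(\cdot)^{\rm Ku}$ with Girard's call-by-value translation $(\cdot)^*$, i.e. $A\mapsto(A^{\rm Ku})^*$. This composition can be presented directly in a modular (and simpler) way as $A\mapsto\,!?A_{{\rm Ku}*}$, i.e. for every formula $A$ of the language of $\mathsf{ILL}_\bot$ the formulas $(A^{\rm Ku})^*$ and $!?A_{{\rm Ku}*}$ are provably equivalent in $\mathsf{CLL}_{\rm b}$, where $A_{{\rm Ku}*}$ is defined inductively by: $P_{{\rm Ku}*}:=\,!P$ for $P$ atomic; $(A\otimes B)_{{\rm Ku}*}:=A_{{\rm Ku}*}\otimes B_{{\rm Ku}*}$; $(A\& B)_{{\rm Ku}*}:=\,!(A_{{\rm Ku}*}\& B_{{\rm Ku}*})$; $(A\oplus B)_{{\rm Ku}*}:=A_{{\rm Ku}*}\oplus B_{{\rm Ku}*}$; $(A\multimap B)_{{\rm Ku}*}:=\,!(A_{{\rm Ku}*}\multimap B_{{\rm Ku}*})$; $(\forall xA)_{{\rm Ku}*}:=\,!\forall x\,?A_{{\rm Ku}*}$; $(\exists xA)_{{\rm Ku}*}:=\exists xA_{{\rm Ku}*}$; $(!A)_{{\rm Ku}*}:=\,!A_{{\rm Ku}*}$.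
   Context: Intuitionistic linear logic $\mathsf{ILL}$ (first order). Formulas are built from atomic formulas, including the constants $1,\top,0$, using $\otimes,\&,\oplus,\multimap$, $\forall x,\exists x$ and $!$. Sequents are $\Gamma\vdash A$ with $\Gamma$ a finite multiset of formulas and exactly one formula on the right. Axioms: $A\vdash A$; $\vdash 1$; $\Gamma\vdash\top$; $\Gamma,0\vdash C$. Rules (premises $\Rightarrow$ conclusion): (cut) $\Gamma\vdash A;\ \Delta,A\vdash C\Rightarrow\Gamma,\Delta\vdash C$; $\Gamma\vdash C\Rightarrow\Gamma,1\vdash C$; $\Gamma\vdash A;\ \Delta\vdash B\Rightarrow\Gamma,\Delta\vdash A\otimes B$; $\Gamma,A,B\vdash C\Rightarrow\Gamma,A\otimes B\vdash C$; $\Gamma,A\vdash B\Rightarrow\Gamma\vdash A\multimap B$; $\Gamma\vdash A;\ \Delta,B\vdash C\Rightarrow\Gamma,\Delta,A\multimap B\vdash C$; $\Gamma\vdash A;\ \Gamma\vdash B\Rightarrow\Gamma\vdash A\& B$; $\Gamma,A\vdash C\Rightarrow\Gamma,A\& B\vdash C$; $\Gamma,B\vdash C\Rightarrow\Gamma,A\& B\vdash C$; $\Gamma\vdash A\Rightarrow\Gamma\vdash A\oplus B$; $\Gamma\vdash B\Rightarrow\Gamma\vdash A\oplus B$; $\Gamma,A\vdash C;\ \Gamma,B\vdash C\Rightarrow\Gamma,A\oplus B\vdash C$; $\Gamma\vdash A\Rightarrow\Gamma\vdash\forall xA$; $\Gamma,A[t/x]\vdash C\Rightarrow\Gamma,\forall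 xA\vdash C$; $\Gamma\vdash A[t/x]\Rightarrow\Gamma\vdash\exists xA$; $\Gamma,A\vdash C\Rightarrow\Gamma,\exists xA\vdash C$ (usual eigenvariable conditions); $\Gamma,!A,!A\vdash C\Rightarrow\Gamma,!A\vdash C$; $\Gamma\vdash C\Rightarrow\Gamma,!A\vdash C$; $!\Gamma\vdash A\Rightarrow\,!\Gamma\vdash\,!A$; $\Gamma,A\vdash C\Rightarrow\Gamma,!A\vdash C$. $\mathsf{ILL}_\bot$ extends $\mathsf{ILL}$ by one more constant $\bot$ (also counted as atomic); its sequents have at most one formula on the right (so $C$ in the rules above may be absent), and it has the additional axiom $\bot\vdash$ and rule $\Gamma\vdash\ \Rightarrow\Gamma\vdash\bot$. $\neg A:=A\multimap\bot$ and $?A:=\neg\,!\,\neg A$. $\mathsf{PRO}$: $A\vdash\,!A$; $\mathsf{DNE}$: $\neg\neg A\vdash A$ (axiom schemas). $\mathsf{CLL}_{\rm b}:=\mathsf{ILL}_\bot+\mathsf{DNE}$; $\mathsf{CL}_{\rm b}:=\mathsf{ILL}_\bot+\mathsf{PRO}+\mathsf{DNE}$. Formulas $A,B$ are provably equivalent in $S$ if $S$ proves $(A\multimap B)\&(B\multimap A)$. Kuroda translation: $A^{\rm Ku}:=\neg\neg A_{\rm Ku}$ where $P_{\rm Ku}:=P$ ($P$ atomic); $(A\,\square\,B)_{\rm Ku}:=A_{\rm Ku}\,\square\,B_{\rm Ku}$ for $\square\in\{\otimes,\&,\oplus,\multimap\}$; $(\forall xA)_{\rm Ku}:=\forall x\,\neg\neg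 A_{\rm Ku}$; $(\exists xA)_{\rm Ku}:=\exists xA_{\rm Ku}$; $(!A)_{\rm Ku}:=\,!A_{\rm Ku}$. Call-by-value translation: $P^*:=\,!P$ ($P$ atomic, including $\bot$); $(A\otimes B)^*:=A^*\otimes B^*$; $(A\& B)^*:=\,!(A^*\& B^* )$; $(A\oplus B)^*:=A^*\oplus B^*$; $(A\multimap B)^*:=\,!(A^*\multimap B^* )$; $(\forall xA)^*:=\,!\forall xA^*$; $(\exists xA)^*:=\exists xA^*$; $(!A)^*:=\,!A^*$. *)

(* Defs.v *)
(* Stdlib world. *)
From Stdlib Require Import List Permutation.
From Stdlib Require Vector.
Import ListNotations.

Set Implicit Arguments.
Unset Strict Implicit.

Record signature := Signature {
  fun_symb : Type;
  fun_arity : fun_symb -> nat;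
  pred_symb : Type;
  pred_arity : pred_symb -> nat
}.

(* Variables are de Bruijn indices, so formulas are taken up to renaming of
   bound variables; indices that escape all binders are the free variables. *)
Inductive term (S : signature) : Type :=
| Var : nat -> term S
| App : forall f : fun_symb S, Vector.t (term S) (fun_arity f) -> term S.

Arguments Var {S} _.

Inductive atom (S : signature) : Type :=
| Pred : forall p : pred_symb S, Vector.t (term S) (pred_arity p) -> atom S
| One : atom S
| Top : atom S
| Zero : atom S
| Bot : atom S.

Arguments One {S}.
Arguments Top {S}.
Arguments Zero {S}.
Arguments Bot {S}.

(* [All A] and [Ex A] bind index 0 of [A]. *)
Inductive form (S : signature) : Type :=
| Atom : atom S -> form S
| Tensor : form S -> form S -> form S
| With : form S -> form S -> form S
| Plus : form S -> form S -> form S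
| Lolli : form S -> form S -> form S
| All : form S -> form S
| Ex : form S -> form S
| Bang : form S -> form S.

Declare Scope linear_scope.
Delimit Scope linear_scope with lin.
Bind Scope linear_scope with form.
Infix "⊗" := Tensor (at level 40, left associativity) : linear_scope.
Infix "&&" := With (at level 40, left associativity) : linear_scope.
Infix "⊕" := Plus (at level 50, left associativity) : linear_scope.
Infix "⊸" := Lolli (at level 55, right associativity) : linear_scope.
Local Open Scope linear_scope.

Section Substitution.
Variable S : signature.

Fixpoint subst_term (s : nat -> term S) (t : term S) : term S :=
  match t with
  | Var n => s n
  | App ts => App (Vector.map (subst_term s) ts)
  end.

Definition shift : nat -> term S := fun n => Var (Datatypes.S n).

Definition up (s : nat -> term S) : nat -> term S := fun n =>
  match n with
  | 0 => Var 0
  | Datatypes.S m => subst_term shift (s m)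
  end.

Definition subst_atom (s : nat -> term S) (a : atom S) : atom S :=
  match a with
  | Pred ts => Pred (Vector.map (subst_term s) ts)
  | One => One
  | Top => Top
  | Zero => Zero
  | Bot => Bot
  end.

Fixpoint subst (s : nat -> term S) (A : form S) : form S :=
  match A with
  | Atom a => Atom (subst_atom s a)
  | A ⊗ B => subst s A ⊗ subst s B
  | A && B => subst s A && subst s B
  | A ⊕ B => subst s A ⊕ subst s B
  | A ⊸ B => subst s A ⊸ subst s B
  | All A => All (subst (up s) A)
  | Ex A => Ex (subst (up s) A)
  | Bang A => Bang (subst s A)
  end.

Definition lift (A : form S) : form S := subst shift A.

Definition inst (A : form S) (t : term S) : form S :=
  subst (fun n => match n with 0 => t | Datatypes.S m => Var m end) A.

End Substitution.

(* [ILLbot Ax G C] is derivability in ILL_bot + Ax.  The left-hand side is a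
   list up to [Permutation], i.e. a multiset; the right-hand side is [None] when
   empty.  The eigenvariable of [r_AllR] and [r_ExL] is index 0, which the
   lifting makes fresh for the rest of the sequent. *)
Inductive ILLbot (S : signature) (Ax : list (form S) -> option (form S) -> Prop)
  : list (form S) -> option (form S) -> Prop :=
| r_exch G D C : Permutation G D -> ILLbot Ax G C -> ILLbot Ax D C
| r_axiom G C : Ax G C -> ILLbot Ax G C
| r_id A : ILLbot Ax [A] (Some A)
| r_cut G D A C :
    ILLbot Ax G (Some A) -> ILLbot Ax (A :: D) C -> ILLbot Ax (G ++ D) C
| r_OneR : ILLbot Ax [] (Some (Atom One))
| r_OneL G C : ILLbot Ax G C -> ILLbot Ax (Atom One :: G) C
| r_TopR G : ILLbot Ax G (Some (Atom Top))
| r_ZeroL G C : ILLbot Ax (Atom Zero :: G) C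
| r_BotL : ILLbot Ax [Atom Bot] None
| r_BotR G : ILLbot Ax G None -> ILLbot Ax G (Some (Atom Bot))
| r_TensorR G D A B :
    ILLbot Ax G (Some A) -> ILLbot Ax D (Some B) ->
    ILLbot Ax (G ++ D) (Some (A ⊗ B))
| r_TensorL G A B C :
    ILLbot Ax (A :: B :: G) C -> ILLbot Ax (A ⊗ B :: G) C
| r_LolliR G A B :
    ILLbot Ax (A :: G) (Some B) -> ILLbot Ax G (Some (A ⊸ B))
| r_LolliL G D A B C :
    ILLbot Ax G (Some A) -> ILLbot Ax (B :: D) C ->
    ILLbot Ax ((A ⊸ B) :: G ++ D) C
| r_WithR G A B :
    ILLbot Ax G (Some A) -> ILLbot Ax G (Some B) ->
    ILLbot Ax G (Some (A && B))
| r_WithL1 G A B C : ILLbot Ax (A :: G) C -> ILLbot Ax ((A && B) :: G) C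
| r_WithL2 G A B C : ILLbot Ax (B :: G) C -> ILLbot Ax ((A && B) :: G) C
| r_PlusR1 G A B : ILLbot Ax G (Some A) -> ILLbot Ax G (Some (A ⊕ B))
| r_PlusR2 G A B : ILLbot Ax G (Some B) -> ILLbot Ax G (Some (A ⊕ B))
| r_PlusL G A B C :
    ILLbot Ax (A :: G) C -> ILLbot Ax (B :: G) C ->
    ILLbot Ax ((A ⊕ B) :: G) C
| r_AllR G A :
    ILLbot Ax (map (@lift S) G) (Some A) -> ILLbot Ax G (Some (All A))
| r_AllL G A t C : ILLbot Ax (inst A t :: G) C -> ILLbot Ax (All A :: G) C
| r_ExR G A t : ILLbot Ax G (Some (inst A t)) -> ILLbot Ax G (Some (Ex A))
| r_ExL G A C :
    ILLbot Ax (A :: map (@lift S) G) (option_map (@lift S) C) ->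
    ILLbot Ax (Ex A :: G) C
| r_contr G A C :
    ILLbot Ax (Bang A :: Bang A :: G) C -> ILLbot Ax (Bang A :: G) C
| r_weak G A C : ILLbot Ax G C -> ILLbot Ax (Bang A :: G) C
| r_BangR G A :
    ILLbot Ax (map (@Bang S) G) (Some A) ->
    ILLbot Ax (map (@Bang S) G) (Some (Bang A))
| r_BangL G A C : ILLbot Ax (A :: G) C -> ILLbot Ax (Bang A :: G) C.

Definition neg (S : signature) (A : form S) : form S := A ⊸ Atom Bot.

Definition whynot (S : signature) (A : form S) : form S := neg (Bang (neg A)).

Inductive DNE (S : signature) : list (form S) -> option (form S) -> Prop :=
| DNE_intro A : DNE [neg (neg A)] (Some A).

Definition CLLb (S : signature) : list (form S) -> option (form S) -> Prop :=
  ILLbot (@DNE S).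

Definition provably_equivalent (S : signature)
    (prov : list (form S) -> option (form S) -> Prop) (A B : form S) : Prop :=
  prov [] (Some ((A ⊸ B) && (B ⊸ A))).

Fixpoint Ku_inner (S : signature) (A : form S) : form S :=
  match A with
  | Atom P => Atom P
  | A ⊗ B => Ku_inner A ⊗ Ku_inner B
  | A && B => Ku_inner A && Ku_inner B
  | A ⊕ B => Ku_inner A ⊕ Ku_inner B
  | A ⊸ B => Ku_inner A ⊸ Ku_inner B
  | All A => All (neg (neg (Ku_inner A)))
  | Ex A => Ex (Ku_inner A)
  | Bang A => Bang (Ku_inner A)
  end.

Definition Kuroda (S : signature) (A : form S) : form S :=
  neg (neg (Ku_inner A)).

(* Girard's call-by-value translation. *)
Fixpoint cbv (S : signature) (A : form S) : form S :=
  match A with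
  | Atom P => Bang (Atom P)
  | A ⊗ B => cbv A ⊗ cbv B
  | A && B => Bang (cbv A && cbv B)
  | A ⊕ B => cbv A ⊕ cbv B
  | A ⊸ B => Bang (cbv A ⊸ cbv B)
  | All A => Bang (All (cbv A))
  | Ex A => Ex (cbv A)
  | Bang A => Bang (cbv A)
  end.

Fixpoint Ku_star (S : signature) (A : form S) : form S :=
  match A with
  | Atom P => Bang (Atom P)
  | A ⊗ B => Ku_star A ⊗ Ku_star B
  | A && B => Bang (Ku_star A && Ku_star B)
  | A ⊕ B => Ku_star A ⊕ Ku_star B
  | A ⊸ B => Bang (Ku_star A ⊸ Ku_star B)
  | All A => Bang (All (whynot (Ku_star A)))
  | Ex A => Ex (Ku_star A)
  | Bang A => Bang (Ku_star A)
  end.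

(* Main.v *)
(** Every formula [X] in the image of the call-by-value translation satisfies
    [X ⊢ !X].  For such [X] promotion gives [!(X ⊸ ⊥) ⊢ !(X ⊸ !⊥)], so the
    banged bottoms that [cbv] introduces in a double negation can be removed and
    [cbv (¬¬A)] becomes [!?(cbv A)].  Applied under the quantifier, where moreover
    [!∀x B] and [!∀x !B] are equivalent, this identifies [cbv (Ku_inner A)] with
    [Ku_star A] by induction on [A]. *)
Require Import Defs.
From Stdlib Require Import List Permutation.
Import ListNotations.
Local Open Scope linear_scope.

Section CancelRenaming.
Variable S : signature.

(* [s] undoes [r], and [r] is a renaming; asking [r] to be a renaming makes the
   property stable under [up] without a composition law for substitutions. *)
Definition cancels_renaming (s r : nat -> term S) : Prop :=
  forall n, exists m, r n = Var m /\ s m = Var n.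

Lemma cancels_renaming_up (s r : nat -> term S) :
  cancels_renaming s r -> cancels_renaming (up s) (up r).
Proof.
  intros H [|n]; [now exists 0|].
  destruct (H n) as [m [Hr Hs]]; exists (Datatypes.S m); simpl.
  now rewrite Hr, Hs.
Qed.

Lemma subst_term_cancel (s r : nat -> term S) :
  cancels_renaming s r -> forall t, subst_term s (subst_term r t) = t.
Proof.
  intros H; fix IH 1; intros [n|f ts]; simpl.
  - now destruct (H n) as [m [-> Hs]].
  - f_equal; induction ts as [|t k ts IHts]; simpl; [reflexivity|].
    now rewrite IH, IHts.
Qed.

Lemma subst_cancel (A : form S) : forall s r,
  cancels_renaming s r -> subst s (subst r A) = A.
Proof.
  induction A as [a| | | | | | |]; intros s r H; simpl; f_equal;
    auto using cancels_renaming_up.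
  destruct a as [p ts| | | |]; simpl; try reflexivity.
  f_equal; induction ts as [|t k ts IHts]; simpl; [reflexivity|].
  now rewrite (subst_term_cancel _ _ H), IHts.
Qed.

(** Index 0 is fresh after lifting, so instantiating a lifted quantifier there recovers its body;
    this is how the quantifier rules are matched with their eigenvariable. *)
Lemma inst_up_shift_var0 (A : form S) :
  inst (subst (up (@shift S)) A) (Var 0) = A.
Proof.
  apply subst_cancel; intros [|n]; [now exists 0|].
  now exists (Datatypes.S (Datatypes.S n)).
Qed.

End CancelRenaming.

Section Entailment.
Variables (S : signature) (Ax : list (form S) -> option (form S) -> Prop).
Implicit Types (A B C X : form S).

Notation "A ⊢ B" := (ILLbot Ax [A] (Some B)) (at level 70).
Notation "⊥" := (Atom Bot).

Lemma entails_trans B A C : A ⊢ B -> B ⊢ C -> A ⊢ C.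
Proof. intros HA HB; exact (r_cut HA HB). Qed.

Lemma entails_swap A B C :
  ILLbot Ax [A; B] (Some C) -> ILLbot Ax [B; A] (Some C).
Proof. apply r_exch, perm_swap. Qed.

Lemma modus_ponens A B : ILLbot Ax [A ⊸ B; A] (Some B).
Proof. exact (r_LolliL (D := []) (r_id Ax A) (r_id Ax B)). Qed.

Lemma Bang_elim A : Bang A ⊢ A.
Proof. apply r_BangL, r_id. Qed.

Lemma Bang_promote A B : Bang A ⊢ B -> Bang A ⊢ Bang B.
Proof. exact (r_BangR (G := [A]) (A := B)). Qed.

Lemma Bang_mono A B : A ⊢ B -> Bang A ⊢ Bang B.
Proof. intros H; apply Bang_promote, r_BangL, H. Qed.

Lemma Tensor_mono A A' B B' : A ⊢ A' -> B ⊢ B' -> A ⊗ B ⊢ A' ⊗ B'.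
Proof. intros HA HB; apply r_TensorL; exact (r_TensorR HA HB). Qed.

Lemma With_mono A A' B B' : A ⊢ A' -> B ⊢ B' -> A && B ⊢ A' && B'.
Proof. intros; apply r_WithR; [apply r_WithL1|apply r_WithL2]; auto. Qed.

Lemma Plus_mono A A' B B' : A ⊢ A' -> B ⊢ B' -> A ⊕ B ⊢ A' ⊕ B'.
Proof. intros; apply r_PlusL; [apply r_PlusR1|apply r_PlusR2]; auto. Qed.

Lemma Lolli_mono A A' B B' : A' ⊢ A -> B ⊢ B' -> A ⊸ B ⊢ A' ⊸ B'.
Proof.
  intros HA HB; apply r_LolliR, entails_swap.
  exact (r_LolliL (D := []) HA HB).
Qed.

Lemma All_mono A B : A ⊢ B -> All A ⊢ All B.
Proof.
  intros H; apply r_AllR, (r_AllL (t := Var 0)).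
  now rewrite inst_up_shift_var0.
Qed.

(** The right-hand side is lifted to fit the premise of [r_ExL]; the eigenvariable itself is the
    witness. *)
Lemma Ex_intro A : A ⊢ lift (Ex A).
Proof.
  apply (r_ExR (t := Var 0)).
  rewrite inst_up_shift_var0; apply r_id.
Qed.

Lemma Ex_mono A B : A ⊢ B -> Ex A ⊢ Ex B.
Proof. intros H; apply r_ExL, (entails_trans B); [exact H|apply Ex_intro]. Qed.

Lemma whynot_mono A B : A ⊢ B -> whynot A ⊢ whynot B.
Proof.
  intros H; apply Lolli_mono; [apply Bang_mono, Lolli_mono|]; auto using r_id.
Qed.

(** Lifting preserves the outer [Bang], so promotion is still available once the eigenvariable has
    been introduced. *)
Lemma Bang_All_promote A : Bang (All A) ⊢ Bang (All (Bang A)).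
Proof.
  apply Bang_promote, r_AllR, Bang_promote, r_BangL, (r_AllL (t := Var 0)).
  rewrite inst_up_shift_var0; apply r_id.
Qed.

Lemma cbv_promote A : cbv A ⊢ Bang (cbv A).
Proof.
  induction A as [|A IHA B IHB|A IHA B IHB|A IHA B IHB|A IHA B IHB|A IHA|A IHA|A IHA];
    simpl; try (apply Bang_promote, r_id).
  (* The connectives left without a [Bang] by [cbv] are ⊗, ⊕ and ∃; there the induction hypotheses
     bang the components first. *)
  - apply (entails_trans (Bang (cbv A) ⊗ Bang (cbv B)));
      [now apply Tensor_mono|].
    apply r_TensorL, (r_BangR (G := [_; _])).
    exact (r_TensorR (Bang_elim _) (Bang_elim _)).
  - apply r_PlusL; [apply (entails_trans _ _ _ IHA)|apply (entails_trans _ _ _ IHB)];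
      apply Bang_mono; [apply r_PlusR1|apply r_PlusR2]; apply r_id.
  - apply r_ExL, (entails_trans _ _ _ IHA), (Bang_mono _ (lift (Ex (cbv A)))).
    apply Ex_intro.
Qed.

Lemma Bang_neg_promote X :
  X ⊢ Bang X -> Bang (neg X) ⊢ Bang (X ⊸ Bang ⊥).
Proof.
  (* Cutting with [HX] makes the whole context banged, so promotion can produce [Bang ⊥]. *)
  intros HX; apply Bang_promote, r_LolliR, (r_cut (D := [_]) HX).
  apply (r_BangR (G := [_; _])), r_BangL, entails_swap, r_BangL, modus_ponens.
Qed.

Lemma cbv_neg_neg_elim A : cbv (neg (neg A)) ⊢ Bang (whynot (cbv A)).
Proof.
  apply Bang_mono, Lolli_mono; [|apply Bang_elim].
  apply Bang_neg_promote, cbv_promote.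
Qed.

Lemma cbv_neg_neg_intro A : Bang (whynot (cbv A)) ⊢ cbv (neg (neg A)).
Proof.
  apply (entails_trans (Bang (Bang (neg (cbv A)) ⊸ Bang ⊥))).
  (* Here the role of [X] is played by [Bang (neg (cbv A))], which is already banged. *)
  - apply Bang_neg_promote, Bang_promote, r_id.
  - apply Bang_mono, Lolli_mono; [|apply r_id].
    apply Bang_mono, Lolli_mono; [apply r_id|apply Bang_elim].
Qed.

(** Both directions go through one induction because ⊸ is contravariant on the left. *)
Lemma cbv_Ku_inner_iff A :
  cbv (Ku_inner A) ⊢ Ku_star A /\ Ku_star A ⊢ cbv (Ku_inner A).
Proof.
  induction A as [a|A [] B []|A [] B []|A [] B []|A [] B []|A [H1 H2]|A []|A []];
    cbn [Ku_inner Ku_star];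
    [split; apply r_id| | | | | | |];
    try (split; simpl; auto using Tensor_mono, Plus_mono, Bang_mono, With_mono,
      Lolli_mono, Ex_mono; fail).
  (* Only ∀ remains: the [Bang] under the quantifier is dropped in one direction and restored by
     [Bang_All_promote] in the other. *)
  split.
  - apply Bang_mono, All_mono.
    apply (entails_trans _ _ _ (cbv_neg_neg_elim _)), r_BangL.
    now apply whynot_mono.
  - apply (entails_trans _ _ _ (Bang_All_promote _)), Bang_mono, All_mono.
    apply (entails_trans (Bang (whynot (cbv (Ku_inner A))))).
    + now apply Bang_mono, whynot_mono.
    + apply cbv_neg_neg_intro.
Qed.

End Entailment.

Theorem theorem4 (S : signature) (A : form S) :
  provably_equivalent (@CLLb S) (cbv (Kuroda A)) (Bang (whynot (Ku_star A))).
Proof.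
  (* Both implications pass through [Bang (whynot (cbv (Ku_inner A)))]. *)
  destruct (cbv_Ku_inner_iff S (@DNE S) A) as [H1 H2].
  apply r_WithR; apply r_LolliR.
  - apply (entails_trans _ _ _ _ _ (cbv_neg_neg_elim _ _ _)).
    now apply Bang_mono, whynot_mono.
  - apply (entails_trans _ _ (Bang (whynot (cbv (Ku_inner A)))));
      [now apply Bang_mono, whynot_mono|apply cbv_neg_neg_intro].
Qed.
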